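(* Let $\mathcal{C}$ be a category, let $\mathcal{L}\colon \mathcal{C}^{op}\to\mathbf{CAT}$ be an indexed category (pseudofunctor), let $\mathcal{E}$ be a category, and let $J=(J_1,J_2)\colon\mathcal{E}\to\Sigma_{\mathcal{C}}\mathcal{L}$ be a functor into the Grothendieck construction. Then $J$ has a fibred colimit (a colimit in $\Sigma_{\mathcal C}\mathcal L$ preserved by the projection $\pi_1\colon\Sigma_{\mathcal{C}}\mathcal{L}\to\mathcal{C}$) if and only if $J_1\colon\mathcal{E}\to\mathcal{C}$ has a colimit $(L,\lambda)$, with colimit cocone $\lambda\colon J_1\Rightarrow\Delta_L$, and the functor $$\mathcal{L}(\lambda)\colon\mathcal{L}(L)\longrightarrow\Pi_{\mathcal{E}}(\mathcal{L}\circ J_1^{op}),\qquad Z\longmapsto\bigl(E\mapsto\mathcal{L}(\lambda_E)(Z)\bigr)$$ has a left adjoint $\mathcal{L}_!(\lambda)$. The colimit of $J$ is then given by $(L,\mathcal{L}_!(\lambda)(J_2))$.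
   Context: An indexed category is a category $\mathcal{C}$ with a pseudofunctor $\mathcal{L}\colon\mathcal{C}^{op}\to\mathbf{CAT}$: categories $\mathcal{L}(A)$, functors $\mathcal{L}(f)\colon\mathcal{L}(B)\to\mathcal{L}(A)$ for $f\colon A\to B$, and natural isomorphisms $\eta^A\colon\mathrm{id}\to\mathcal{L}(\mathrm{id}_A)$ (unitors) and $\mu^{f,g}\colon\mathcal{L}(f)\circ\mathcal{L}(g)\to\mathcal{L}(g\circ f)$ (compositors) for $A\xrightarrow{f}B\xrightarrow{g}C$, satisfying the usual coherence laws. The Grothendieck construction $\Sigma_{\mathcal{C}}\mathcal{L}$ has objects pairs $(A,X)$ with $A\in\mathcal{C}$, $X\in\mathcal{L}(A)$; morphisms $(A,X)\to(B,Y)$ are pairs $(f,f')$ with $f\colon A\to B$ in $\mathcal{C}$ and $f'\colon X\to\mathcal{L}(f)(Y)$ in $\mathcal{L}(A)$; the composite of $(f,f')\colon(A,X)\to(B,Y)$ and $(g,g')\colon(B,Y)\to(C,Z)$ is $(g\circ f,\ \mu^{f,g}_Z\circ\mathcal{L}(f)(g')\circ f')$, and identities are $(\mathrm{id}_A,\eta^A_X)$. The projection $\pi_1$ takes first components. For an indexed category $\mathcal{M}\colon\mathcal{E}^{op}\to\mathbf{CAT}$, the category of sections $\Pi_{\mathcal{E}}\mathcal{M}$ has as objects families $(X_E\in\mathcal{M}(E))_{E\in\mathcal{E}}$ with morphisms $\xi_e\colon X_E\to\mathcal{M}(e)(X_{E'})$ in $\mathcal M(E)$ for each $e\colon E\to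 E'$ in $\mathcal{E}$, such that $\xi_{\mathrm{id}_E}$ is the unitor at $X_E$ and $\xi_{e'\circ e}$ equals $\mathcal{M}(e)(\xi_{e'})\circ\xi_e$ followed by the compositor. Morphisms $(X,\xi)\to(Y,\zeta)$ are families $\alpha_E\colon X_E\to Y_E$ with $\mathcal{M}(e)(\alpha_{E'})\circ\xi_e=\zeta_e\circ\alpha_E$. A functor $J\colon\mathcal{E}\to\Sigma_{\mathcal{C}}\mathcal{L}$ is the same as a pair $(J_1,J_2)$ of a functor $J_1\colon\mathcal{E}\to\mathcal{C}$ and a section $J_2\in\Pi_{\mathcal{E}}(\mathcal{L}\circ J_1^{op})$. The section $E\mapsto\mathcal{L}(\lambda_E)(Z)$ has as structure maps the inverse compositors $\mathcal{L}(\lambda_E)(Z)=\mathcal{L}(\lambda_{E'}\circ J_1(e))(Z)\cong\mathcal{L}(J_1(e))\mathcal{L}(\lambda_{E'})(Z)$ for $e\colon E\to E'$.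
   Formalization: ''Only if'' fails for one fixed J. Proved instead: J has a fibred colimit iff J_1 has a colimit and L(λ) a left adjoint at J_2 alone; all sections over J_1 give fibred colimits iff J_1 has a colimit and L(λ) a full left adjoint. The ''if'' part and the colimit formula are kept. *)

(* Defs.v *)
From Stdlib Require Import FunctionalExtensionality ProofIrrelevance.

Set Implicit Arguments.
Unset Strict Implicit.
Unset Printing Implicit Defensive.
#[local] Obligation Tactic := simpl; intros.

Declare Scope cat_scope.
Delimit Scope cat_scope with cat.
Local Open Scope cat_scope.

Record Category : Type := {
  ob :> Type;
  hom : ob -> ob -> Type;
  idm : forall A, hom A A;
  comp : forall A B C, hom B C -> hom A B -> hom A C;
  comp_idl : forall A B (f : hom A B), comp (idm B) f = f;
  comp_idr : forall A B (f : hom A B), comp f (idm A) = f;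
  comp_assoc : forall A B C D (h : hom C D) (g : hom B C) (f : hom A B),
    comp (comp h g) f = comp h (comp g f)
}.
Arguments hom {c} A B.
Arguments idm {c} A.
Arguments comp {c A B C} g f.
Arguments comp_idl {c A B} f.
Arguments comp_idr {c A B} f.
Arguments comp_assoc {c A B C D} h g f.
Notation "g ∘ f" := (comp g f) (at level 40, left associativity) : cat_scope.

Record Functor (C D : Category) : Type := {
  fobj :> C -> D;
  fmap : forall A B, hom A B -> hom (fobj A) (fobj B);
  fmap_id : forall A, fmap (idm A) = idm (fobj A);
  fmap_comp : forall A B C (g : hom B C) (f : hom A B),
    fmap (g ∘ f) = fmap g ∘ fmap f
}.
Arguments fmap {C D} F {A B} f : rename.
Arguments fmap_id {C D} F A : rename.
Arguments fmap_comp {C D} F {A B C} g f : rename.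

Definition id_functor (C : Category) : Functor C C :=
  {| fobj := fun A => A;
     fmap := fun _ _ f => f;
     fmap_id := fun _ => eq_refl;
     fmap_comp := fun _ _ _ _ _ => eq_refl |}.

Program Definition comp_functor (C D E : Category)
  (G : Functor D E) (F : Functor C D) : Functor C E :=
  {| fobj := fun A => G (F A);
     fmap := fun _ _ f => fmap G (fmap F f) |}.
Next Obligation. now rewrite !fmap_id. Qed.
Next Obligation. now rewrite !fmap_comp. Qed.

Record NatTrans (C D : Category) (F G : Functor C D) : Type := {
  component :> forall A, hom (F A) (G A);
  naturality : forall A B (f : hom A B),
    component B ∘ fmap F f = fmap G f ∘ component A
}.
Arguments naturality {C D F G} n {A B} f.

Record NatIso (C D : Category) (F G : Functor C D) : Type := {
  iso_fwd :> NatTrans F G;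
  iso_bwd : NatTrans G F;
  iso_bwd_fwd : forall A, iso_bwd A ∘ iso_fwd A = idm (F A);
  iso_fwd_bwd : forall A, iso_fwd A ∘ iso_bwd A = idm (G A)
}.

Record Cocone (E C : Category) (J : Functor E C) : Type := {
  apex : C;
  leg : forall e, hom (J e) apex;
  leg_comp : forall e e' (u : hom e e'), leg e' ∘ fmap J u = leg e
}.
Arguments leg_comp {E C J} c {e e'} u.

Definition is_colimit (E C : Category) (J : Functor E C) (c : Cocone J) : Prop :=
  forall d : Cocone J,
    exists! f : hom (apex c) (apex d), forall e, f ∘ leg c e = leg d e.

Program Definition map_cocone (E C D : Category) (H : Functor C D)
  (J : Functor E C) (c : Cocone J) : Cocone (comp_functor H J) :=
  {| apex := H (apex c); leg := fun e => fmap H (leg c e) |}.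
Next Obligation. now rewrite <- fmap_comp, leg_comp. Qed.

Record Adjunction (A B : Category) (F : Functor A B) (U : Functor B A) : Type := {
  adj_unit : NatTrans (id_functor A) (comp_functor U F);
  adj_counit : NatTrans (comp_functor F U) (id_functor B);
  adj_triangle_l : forall X, adj_counit (F X) ∘ fmap F (adj_unit X) = idm (F X);
  adj_triangle_r : forall Y, fmap U (adj_counit Y) ∘ adj_unit (U Y) = idm (U Y)
}.

Definition has_left_adjoint (A B : Category) (U : Functor B A) : Prop :=
  exists F : Functor A B, inhabited (Adjunction F U).

(* [U] has a left adjoint with value [X] and unit [u] at the single object [S];
   [has_left_adjoint U] amounts to such data at every [S]. *)
Definition is_universal_arrow (A B : Category) (U : Functor B A)
  (S : A) (X : B) (u : hom S (U X)) : Prop :=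
  forall (Y : B) (f : hom S (U Y)), exists! g : hom X Y, fmap U g ∘ u = f.

Definition has_left_adjoint_at (A B : Category) (U : Functor B A) (S : A) : Prop :=
  exists (X : B) (u : hom S (U X)), is_universal_arrow u.

(* The unit and associativity laws of a pseudofunctor compare [reind f Y] and
   [reind g Y] for [f] and [g] that are only propositionally equal; [recast] is
   the resulting identity morphism. *)
Definition recast (C : Category) (fiber : C -> Category)
  (reind : forall A B : C, hom A B -> Functor (fiber B) (fiber A))
  (A B : C) (f g : hom A B) (p : f = g) (Y : fiber B) :
  hom (reind A B f Y) (reind A B g Y) :=
  match p in _ = g return hom (reind A B f Y) (reind A B g Y) with
  | eq_refl => idm (reind A B f Y)
  end.

Record IndexedCategory (C : Category) : Type := {
  fiber :> C -> Category;
  reind : forall A B : C, hom A B -> Functor (fiber B) (fiber A);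
  unitor : forall A, NatIso (id_functor (fiber A)) (reind (idm A));
  compositor : forall (A B D : C) (f : hom A B) (g : hom B D),
    NatIso (comp_functor (reind f) (reind g)) (reind (g ∘ f));
  unitor_l : forall (A B : C) (f : hom A B) (Y : fiber B),
    recast reind (comp_idr f) Y ∘
      (compositor (idm A) f Y ∘ unitor A (reind f Y)) = idm (reind f Y);
  unitor_r : forall (A B : C) (f : hom A B) (Y : fiber B),
    recast reind (comp_idl f) Y ∘
      (compositor f (idm B) Y ∘ fmap (reind f) (unitor B Y)) = idm (reind f Y);
  compositor_assoc : forall (A B D G : C)
      (f : hom A B) (g : hom B D) (h : hom D G) (Z : fiber G),
    recast reind (comp_assoc h g f) Z ∘
      (compositor f (h ∘ g) Z ∘ fmap (reind f) (compositor g h Z)) =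
    compositor (g ∘ f) h Z ∘ compositor f g (reind h Z)
}.
Arguments reind {C} L {A B} f : rename.
Arguments unitor {C} L A : rename.
Arguments compositor {C} L {A B D} f g : rename.
Arguments unitor_l {C} L {A B} f Y : rename.
Arguments unitor_r {C} L {A B} f Y : rename.
Arguments compositor_assoc {C} L {A B D G} f g h Z : rename.

Section RecastTheory.
Context {C : Category} (L : IndexedCategory C).

Notation rc := (recast (@reind C L)).

Lemma recast_refl (A B : C) (f : hom A B) (p : f = f) (Y : L B) :
  rc p Y = idm _.
Proof. now rewrite (proof_irrelevance _ p eq_refl). Qed.

Lemma recast_trans (A B : C) (f g h : hom A B) (p : f = g) (q : g = h) (r : f = h)
  (Y : L B) : rc q Y ∘ rc p Y = rc r Y.
Proof. subst h g; rewrite !recast_refl; apply comp_idl. Qed.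

Lemma recast_transx (A B : C) (f g h : hom A B) (p : f = g) (q : g = h) (Y : L B)
  (X : L A) (x : hom X (reind L f Y)) :
  rc q Y ∘ (rc p Y ∘ x) = rc (eq_trans p q) Y ∘ x.
Proof. subst h g; rewrite !recast_refl, !comp_idl; reflexivity. Qed.

Lemma recast_cancel (A B : C) (f g : hom A B) (p : f = g) (q : g = f) (Y : L B)
  (X : L A) (x : hom X (reind L f Y)) : rc q Y ∘ (rc p Y ∘ x) = x.
Proof. subst g; rewrite !recast_refl, !comp_idl; reflexivity. Qed.

Lemma recast_natural (A B : C) (f g : hom A B) (p : f = g) (Y Z : L B)
  (y : hom Y Z) :
  rc p Z ∘ fmap (reind L f) y = fmap (reind L g) y ∘ rc p Y.
Proof. subst g; simpl; now rewrite comp_idl, comp_idr. Qed.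

(* Domains and codomains below are given explicitly so that they are not stated
   through [id_functor] and [comp_functor]. *)

Lemma recast_compositor_l (A B D : C) (f f' : hom A B) (g : hom B D)
  (p : f = f') (q : g ∘ f = g ∘ f') (Z : L D) :
  comp (A := reind L f (reind L g Z)) (B := reind L f' (reind L g Z))
    (compositor L f' g Z) (rc p (reind L g Z)) =
  comp (A := reind L f (reind L g Z)) (rc q Z) (compositor L f g Z).
Proof. subst f'; rewrite !recast_refl, comp_idl; apply comp_idr. Qed.

Lemma recast_compositor_r (A B D : C) (f : hom A B) (g g' : hom B D)
  (p : g = g') (q : g ∘ f = g' ∘ f) (Z : L D) :
  comp (A := reind L f (reind L g Z)) (B := reind L f (reind L g' Z))
    (compositor L f g' Z) (fmap (reind L f) (rc p Z)) =
  comp (A := reind L f (reind L g Z)) (rc q Z) (compositor L f g Z).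
Proof. subst g'; rewrite !recast_refl, comp_idl, fmap_id; apply comp_idr. Qed.

Lemma recast_compositor_lx (A B D : C) (f f' : hom A B) (g : hom B D)
  (p : f = f') (q : g ∘ f = g ∘ f') (Z : L D) (X : L A)
  (x : hom X (reind L f (reind L g Z))) :
  comp (B := reind L f' (reind L g Z)) (compositor L f' g Z)
    (rc p (reind L g Z) ∘ x) =
  rc q Z ∘ comp (B := reind L f (reind L g Z)) (compositor L f g Z) x.
Proof.
  now rewrite <- comp_assoc, (recast_compositor_l p q), comp_assoc.
Qed.

Lemma recast_compositor_rx (A B D : C) (f : hom A B) (g g' : hom B D)
  (p : g = g') (q : g ∘ f = g' ∘ f) (Z : L D) (X : L A)
  (x : hom X (reind L f (reind L g Z))) :
  comp (B := reind L f (reind L g' Z)) (compositor L f g' Z)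
    (fmap (reind L f) (rc p Z) ∘ x) =
  rc q Z ∘ comp (B := reind L f (reind L g Z)) (compositor L f g Z) x.
Proof.
  now rewrite <- comp_assoc, (recast_compositor_r p q), comp_assoc.
Qed.

Lemma unitor_natural (A : C) (X Y : L A) (y : hom X Y) :
  comp (B := Y) (unitor L A Y) y =
  comp (A := X) (fmap (reind L (idm A)) y) (unitor L A X).
Proof. exact (naturality (unitor L A) y). Qed.

Lemma unitor_inv_natural (A : C) (X Y : L A) (y : hom X Y) :
  comp (C := Y) (iso_bwd (unitor L A) Y) (fmap (reind L (idm A)) y) =
  comp (B := X) y (iso_bwd (unitor L A) X).
Proof. exact (naturality (iso_bwd (unitor L A)) y). Qed.

Lemma unitor_bwd_fwd (A : C) (Y : L A) :
  comp (A := Y) (C := Y) (iso_bwd (unitor L A) Y) (unitor L A Y) = idm Y.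
Proof. exact (iso_bwd_fwd (unitor L A) Y). Qed.

Lemma unitor_fwd_bwd (A : C) (Y : L A) :
  comp (B := Y) (unitor L A Y) (iso_bwd (unitor L A) Y) = idm (reind L (idm A) Y).
Proof. exact (iso_fwd_bwd (unitor L A) Y). Qed.

Lemma compositor_natural (A B D : C) (f : hom A B) (g : hom B D) (X Y : L D)
  (y : hom X Y) :
  comp (B := reind L f (reind L g Y))
    (compositor L f g Y) (fmap (reind L f) (fmap (reind L g) y)) =
  comp (A := reind L f (reind L g X))
    (fmap (reind L (g ∘ f)) y) (compositor L f g X).
Proof. exact (naturality (compositor L f g) y). Qed.

Lemma compositor_inv_natural (A B D : C) (f : hom A B) (g : hom B D) (X Y : L D)
  (y : hom X Y) :
  comp (C := reind L f (reind L g Y))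
    (iso_bwd (compositor L f g) Y) (fmap (reind L (g ∘ f)) y) =
  comp (B := reind L f (reind L g X))
    (fmap (reind L f) (fmap (reind L g) y)) (iso_bwd (compositor L f g) X).
Proof. exact (naturality (iso_bwd (compositor L f g)) y). Qed.

Lemma compositor_bwd_fwd (A B D : C) (f : hom A B) (g : hom B D) (Y : L D) :
  comp (A := reind L f (reind L g Y)) (C := reind L f (reind L g Y))
    (iso_bwd (compositor L f g) Y) (compositor L f g Y) = idm (reind L f (reind L g Y)).
Proof. exact (iso_bwd_fwd (compositor L f g) Y). Qed.

Lemma compositor_fwd_bwd (A B D : C) (f : hom A B) (g : hom B D) (Y : L D) :
  comp (B := reind L f (reind L g Y))
    (compositor L f g Y) (iso_bwd (compositor L f g) Y) = idm (reind L (g ∘ f) Y).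
Proof. exact (iso_fwd_bwd (compositor L f g) Y). Qed.

Lemma unitor_cancel (A : C) (X Y : L A) (x : hom X (reind L (idm A) Y)) :
  comp (B := Y) (unitor L A Y) (comp (C := Y) (iso_bwd (unitor L A) Y) x) = x.
Proof. now rewrite <- comp_assoc, unitor_fwd_bwd, comp_idl. Qed.

Lemma compositor_cancel (A B D : C) (f : hom A B) (g : hom B D) (X : L A) (Y : L D)
  (x : hom X (reind L (g ∘ f) Y)) :
  comp (B := reind L f (reind L g Y)) (compositor L f g Y)
    (comp (C := reind L f (reind L g Y)) (iso_bwd (compositor L f g) Y) x) = x.
Proof. now rewrite <- comp_assoc, compositor_fwd_bwd, comp_idl. Qed.

Lemma fmap_compositor_cancel (A' A B D : C) (k : hom A' A) (f : hom A B) (g : hom B D)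
  (X : L A') (Y : L D) (x : hom X (reind L k (reind L (g ∘ f) Y))) :
  comp (B := reind L k (reind L f (reind L g Y)))
    (fmap (A := reind L f (reind L g Y)) (reind L k) (compositor L f g Y))
    (comp (C := reind L k (reind L f (reind L g Y)))
       (fmap (B := reind L f (reind L g Y)) (reind L k)
          (iso_bwd (compositor L f g) Y)) x) = x.
Proof.
  rewrite <- comp_assoc.
  rewrite <- (@fmap_comp _ _ (reind L k) _ (reind L f (reind L g Y))).
  rewrite compositor_fwd_bwd, fmap_id; apply comp_idl.
Qed.

Lemma unitor_law_l (A B : C) (f : hom A B) (Y : L B) (p : f ∘ idm A = f) :
  comp (A := reind L f Y) (rc p Y)
    (comp (A := reind L f Y) (B := reind L (idm A) (reind L f Y))
       (compositor L (idm A) f Y) (unitor L A (reind L f Y))) = idm (reind L f Y).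
Proof. rewrite (proof_irrelevance _ p (comp_idr f)); exact (unitor_l L f Y). Qed.

Lemma unitor_law_r (A B : C) (f : hom A B) (Y : L B) (p : idm B ∘ f = f) :
  comp (A := reind L f Y) (rc p Y)
    (comp (A := reind L f Y) (B := reind L f (reind L (idm B) Y))
       (compositor L f (idm B) Y) (fmap (A := Y) (reind L f) (unitor L B Y))) =
  idm (reind L f Y).
Proof. rewrite (proof_irrelevance _ p (comp_idl f)); exact (unitor_r L f Y). Qed.

Lemma compositor_law (A B D G : C) (f : hom A B) (g : hom B D) (h : hom D G)
  (Z : L G) (p : (h ∘ g) ∘ f = h ∘ (g ∘ f)) :
  comp (A := reind L f (reind L g (reind L h Z))) (rc p Z)
    (comp (A := reind L f (reind L g (reind L h Z)))
       (B := reind L f (reind L (h ∘ g) Z))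
       (compositor L f (h ∘ g) Z)
       (fmap (A := reind L g (reind L h Z)) (reind L f) (compositor L g h Z))) =
  comp (A := reind L f (reind L g (reind L h Z)))
    (B := reind L (g ∘ f) (reind L h Z))
    (compositor L (g ∘ f) h Z) (compositor L f g (reind L h Z)).
Proof.
  rewrite (proof_irrelevance _ p (comp_assoc h g f)); exact (compositor_assoc L f g h Z).
Qed.

Lemma compositor_moveL (A B D : C) (f : hom A B) (g : hom B D) (X : L A) (Y : L D)
  (x : hom X (reind L f (reind L g Y))) (y : hom X (reind L (g ∘ f) Y)) :
  comp (B := reind L f (reind L g Y)) (compositor L f g Y) x = y ->
  comp (C := reind L f (reind L g Y)) (iso_bwd (compositor L f g) Y) y = x.
Proof. intros <-; now rewrite <- comp_assoc, compositor_bwd_fwd, comp_idl. Qed.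

Lemma compositor_naturalx (A B D : C) (f : hom A B) (g : hom B D) (X Y : L D)
  (y : hom X Y) (W : L A) (w : hom W (reind L f (reind L g X))) :
  comp (B := reind L f (reind L g Y))
    (compositor L f g Y) (fmap (reind L f) (fmap (reind L g) y) ∘ w) =
  fmap (reind L (g ∘ f)) y ∘
    comp (B := reind L f (reind L g X)) (compositor L f g X) w.
Proof. now rewrite <- comp_assoc, compositor_natural, comp_assoc. Qed.

Lemma compositor_lawx (A B D G : C) (f : hom A B) (g : hom B D) (h : hom D G)
  (Z : L G) (p : h ∘ (g ∘ f) = (h ∘ g) ∘ f) (X : L A)
  (x : hom X (reind L f (reind L g (reind L h Z)))) :
  comp (B := reind L (g ∘ f) (reind L h Z)) (compositor L (g ∘ f) h Z)
    (comp (B := reind L f (reind L g (reind L h Z)))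
       (compositor L f g (reind L h Z)) x) =
  rc (eq_sym p) Z ∘
    (comp (B := reind L f (reind L (h ∘ g) Z)) (compositor L f (h ∘ g) Z)
       (comp (B := reind L f (reind L g (reind L h Z)))
          (fmap (A := reind L g (reind L h Z)) (reind L f) (compositor L g h Z)) x)).
Proof.
  now rewrite <- (@comp_assoc (L A)), <- (compositor_law _ (eq_sym p)), !(@comp_assoc (L A)).
Qed.

End RecastTheory.

Section Reindex.
Context {C E : Category} (L : IndexedCategory C) (F : Functor E C).

Notation rc := (recast (@reind C L)).
Notation rcF := (@recast E (fun e => L (F e)) (fun _ _ u => reind L (fmap F u))).

Lemma recast_reindex (a b : E) (u v : hom a b) (p : u = v) (Y : L (F b)) :
  rcF p Y = rc (f_equal (@fmap _ _ F a b) p) Y.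
Proof. subst v; now rewrite recast_refl. Qed.

(* The unit and compositor of [L ∘ F^op] are those of [L], recast along
   [fmap_id F] and [fmap_comp F]. *)
Program Definition reindex_unitor (e : E) :
  NatIso (id_functor (L (F e))) (reind L (fmap F (idm e))) :=
  {| iso_fwd := {| component := fun X =>
       rc (eq_sym (fmap_id F e)) X ∘ unitor L (F e) X |};
     iso_bwd := {| component := fun X =>
       iso_bwd (unitor L (F e)) X ∘ rc (fmap_id F e) X |} |}.
Next Obligation.
  now rewrite comp_assoc, unitor_natural, <- !comp_assoc, recast_natural.
Qed.
Next Obligation.
  now rewrite comp_assoc, recast_natural, <- !comp_assoc, unitor_inv_natural.
Qed.
Next Obligation.
  now rewrite comp_assoc, recast_cancel, unitor_bwd_fwd.
Qed.
Next Obligation.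
  rewrite comp_assoc, unitor_cancel; apply (recast_trans _ _ eq_refl).
Qed.

Program Definition reindex_compositor (a b d : E) (u : hom a b) (v : hom b d) :
  NatIso (comp_functor (reind L (fmap F u)) (reind L (fmap F v)))
         (reind L (fmap F (v ∘ u))) :=
  {| iso_fwd := {| component := fun X =>
       rc (eq_sym (fmap_comp F v u)) X ∘ compositor L (fmap F u) (fmap F v) X |};
     iso_bwd := {| component := fun X =>
       iso_bwd (compositor L (fmap F u) (fmap F v)) X ∘ rc (fmap_comp F v u) X |} |}.
Next Obligation.
  now rewrite comp_assoc, compositor_natural, <- !comp_assoc, recast_natural.
Qed.
Next Obligation.
  now rewrite comp_assoc, recast_natural, <- !comp_assoc, compositor_inv_natural.
Qed.
Next Obligation.
  now rewrite comp_assoc, recast_cancel, compositor_bwd_fwd.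
Qed.
Next Obligation.
  rewrite comp_assoc, compositor_cancel; apply (recast_trans _ _ eq_refl).
Qed.

Program Definition reindex : IndexedCategory E :=
  {| fiber := fun e => L (F e);
     reind := fun _ _ u => reind L (fmap F u);
     unitor := reindex_unitor;
     compositor := fun _ _ _ u v => reindex_compositor u v |}.
Next Obligation.
  assert (q : fmap F f ∘ idm (F A) = fmap F f ∘ fmap F (idm A)) by now rewrite fmap_id.
  rewrite recast_reindex, !comp_assoc, (recast_compositor_lx _ q), !recast_transx.
  apply unitor_law_l.
Qed.
Next Obligation.
  assert (q : idm (F B) ∘ fmap F f = fmap F (idm B) ∘ fmap F f) by now rewrite fmap_id.
  rewrite recast_reindex, (fmap_comp (reind L (fmap F f))), !comp_assoc, (recast_compositor_rx _ q).
  rewrite !recast_transx; apply unitor_law_r.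
Qed.
Next Obligation.
  assert (q : (fmap F h ∘ fmap F g) ∘ fmap F f = fmap F (h ∘ g) ∘ fmap F f)
    by now rewrite fmap_comp.
  assert (r : fmap F h ∘ (fmap F g ∘ fmap F f) = fmap F h ∘ fmap F (g ∘ f))
    by now rewrite fmap_comp.
  rewrite recast_reindex, (fmap_comp (reind L (fmap F f))), !(@comp_assoc (L (F A))).
  rewrite (recast_compositor_rx _ q), (recast_compositor_lx _ r).
  rewrite <- (compositor_law _ (comp_assoc _ _ _)), !recast_transx.
  do 2 f_equal; apply proof_irrelevance.
Qed.

End Reindex.

Section Grothendieck.
Context {C : Category} (L : IndexedCategory C).

Notation rc := (recast (@reind C L)).

#[local] Set Primitive Projections.

Record GrothOb : Type := {
  gbase : C;
  gfib : L gbase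
}.

Record GrothHom (P Q : GrothOb) : Type := {
  gfst : hom (gbase P) (gbase Q);
  gsnd : hom (gfib P) (reind L gfst (gfib Q))
}.

#[local] Unset Primitive Projections.

Lemma groth_hom_eq (P Q : GrothOb) (m n : GrothHom P Q) (p : gfst m = gfst n) :
  rc p (gfib Q) ∘ gsnd m = gsnd n -> m = n.
Proof.
  destruct m as [m1 m2], n as [n1 n2]; simpl in *; subst n1; simpl.
  rewrite comp_idl; now intros <-.
Qed.

Arguments groth_hom_eq {P Q m n} p _.

Lemma groth_hom_eq_snd (P Q : GrothOb) (m n : GrothHom P Q) (e : m = n)
  (p : gfst m = gfst n) : rc p (gfib Q) ∘ gsnd m = gsnd n.
Proof. subst n; rewrite recast_refl; apply comp_idl. Qed.

Definition groth_id (P : GrothOb) : GrothHom P P :=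
  {| gfst := idm (gbase P); gsnd := unitor L (gbase P) (gfib P) |}.

Definition groth_comp (P Q R : GrothOb) (n : GrothHom Q R) (m : GrothHom P Q) :
  GrothHom P R :=
  {| gfst := gfst n ∘ gfst m;
     gsnd := comp (B := reind L (gfst m) (reind L (gfst n) (gfib R)))
               (compositor L (gfst m) (gfst n) (gfib R))
               (fmap (reind L (gfst m)) (gsnd n) ∘ gsnd m) |}.

Program Definition Groth : Category :=
  {| ob := GrothOb; hom := GrothHom; idm := groth_id; comp := groth_comp |}.
Next Obligation.
  apply (groth_hom_eq (m := groth_comp (groth_id B) f) (n := f) (comp_idl (gfst f))).
  simpl; rewrite <- !comp_assoc, (comp_assoc (rc _ _)), unitor_law_r; apply comp_idl.
Qed.
Next Obligation.
  apply (groth_hom_eq (m := groth_comp f (groth_id A)) (n := f) (comp_idr (gfst f))).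
  simpl; rewrite <- unitor_natural, <- !comp_assoc, (comp_assoc (rc _ _)), unitor_law_l.
  apply comp_idl.
Qed.
Next Obligation.
  apply (groth_hom_eq (m := groth_comp (groth_comp h g) f)
    (n := groth_comp h (groth_comp g f)) (comp_assoc (gfst h) (gfst g) (gfst f))).
  simpl; rewrite !fmap_comp, !(@comp_assoc (L (gbase A))).
  rewrite <- compositor_naturalx.
  rewrite (compositor_lawx (eq_sym (comp_assoc (gfst h) (gfst g) (gfst f)))).
  do 2 f_equal; apply proof_irrelevance.
Qed.

Program Definition groth_proj : Functor Groth C :=
  {| fobj := fun P : Groth => gbase P;
     fmap := fun (P Q : Groth) (m : hom P Q) => gfst m |}.
Next Obligation. reflexivity. Qed.
Next Obligation. reflexivity. Qed.

End Grothendieck.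
Arguments Build_GrothOb {C L} gbase gfib.
Arguments Build_GrothHom {C L} P Q gfst gsnd.
Arguments groth_hom_eq {C L P Q m n} p _.

Section Sections.
Context {E : Category} (M : IndexedCategory E).

Record Sect : Type := {
  sec_ob :> forall e, M e;
  sec_map : forall e e' (u : hom e e'), hom (sec_ob e) (reind M u (sec_ob e'));
  sec_id : forall e, sec_map (idm e) = unitor M e (sec_ob e);
  sec_comp : forall e e' e'' (v : hom e' e'') (u : hom e e'),
    sec_map (v ∘ u) =
    comp (B := reind M u (reind M v (sec_ob e'')))
      (compositor M u v (sec_ob e''))
      (fmap (reind M u) (sec_map v) ∘ sec_map u)
}.
Arguments sec_map S {e e'} u : rename.

Record SectHom (S T : Sect) : Type := {
  sec_hom :> forall e, hom (S e) (T e);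
  sec_hom_comp : forall e e' (u : hom e e'),
    fmap (reind M u) (sec_hom e') ∘ sec_map S u = sec_map T u ∘ sec_hom e
}.

Lemma sect_hom_eq (S T : Sect) (a b : SectHom S T) : (forall e, a e = b e) -> a = b.
Proof.
  destruct a as [a Ha], b as [b Hb]; simpl; intros H.
  assert (a = b) as -> by now apply functional_extensionality_dep.
  now rewrite (proof_irrelevance _ Ha Hb).
Qed.

Program Definition sect_id (S : Sect) : SectHom S S :=
  {| sec_hom := fun e => idm (S e) |}.
Next Obligation. now rewrite fmap_id, comp_idl, comp_idr. Qed.

Program Definition sect_comp (S T U : Sect) (b : SectHom T U) (a : SectHom S T) :
  SectHom S U :=
  {| sec_hom := fun e => b e ∘ a e |}.
Next Obligation.
  now rewrite fmap_comp, comp_assoc, sec_hom_comp, <- !comp_assoc, sec_hom_comp.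
Qed.

Program Definition SectCat : Category :=
  {| ob := Sect; hom := SectHom; idm := sect_id; comp := sect_comp |}.
Next Obligation. apply sect_hom_eq; intros e; apply comp_idl. Qed.
Next Obligation. apply sect_hom_eq; intros e; apply comp_idr. Qed.
Next Obligation. apply sect_hom_eq; intros e; apply comp_assoc. Qed.

End Sections.
Arguments sec_map {E M} S {e e'} u : rename.

Section Pairs.
Context {C E : Category} (L : IndexedCategory C).

Notation rc := (recast (@reind C L)).

Definition fst_part (J : Functor E (Groth L)) : Functor E C :=
  comp_functor (groth_proj L) J.

Program Definition snd_part (J : Functor E (Groth L)) :
  SectCat (reindex L (fst_part J)) :=
  {| sec_ob := fun e => gfib (J e);
     sec_map := fun e e' u => gsnd (fmap J u) |}.
Next Obligation.
  symmetry; apply (groth_hom_eq_snd (m := groth_id (J e)) (n := fmap J (idm e))).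
  symmetry; apply (fmap_id J).
Qed.
Next Obligation.
  symmetry; rewrite comp_assoc.
  apply (groth_hom_eq_snd (m := groth_comp (fmap J v) (fmap J u)) (n := fmap J (v ∘ u))).
  symmetry; apply (fmap_comp J).
Qed.

Definition pair_ob (J1 : Functor E C) (S : SectCat (reindex L J1)) (e : E) :
  Groth L :=
  {| gbase := J1 e; gfib := S e |}.

Definition pair_map (J1 : Functor E C) (S : SectCat (reindex L J1)) (e e' : E)
  (u : hom e e') : hom (pair_ob S e) (pair_ob S e') :=
  Build_GrothHom (pair_ob S e) (pair_ob S e') (fmap J1 u) (sec_map S u).

Program Definition pair_functor (J1 : Functor E C) (S : SectCat (reindex L J1)) :
  Functor E (Groth L) :=
  {| fobj := pair_ob S; fmap := pair_map S |}.
Next Obligation.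
  symmetry; apply (groth_hom_eq (m := groth_id (pair_ob S A)) (n := pair_map S (idm A))
    (eq_sym (fmap_id J1 A))).
  simpl; now rewrite sec_id.
Qed.
Next Obligation.
  symmetry; apply (groth_hom_eq (m := groth_comp (pair_map S g) (pair_map S f))
    (n := pair_map S (g ∘ f)) (eq_sym (fmap_comp J1 g f))).
  simpl; now rewrite sec_comp; simpl; rewrite comp_assoc.
Qed.

Lemma pair_functor_parts (J : Functor E (Groth L)) :
  pair_functor (J1 := fst_part J) (snd_part J) = J.
Proof.
  destruct J as [J0 J1 i c]; unfold pair_functor; simpl.
  f_equal; apply proof_irrelevance.
Qed.

Lemma sect_over_eq (F0 : E -> C)
  (F1 : forall a b : E, hom a b -> hom (F0 a) (F0 b)) i i' c c' S0 S1 Si Sc Si' Sc' :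
  existT (fun F => Sect (reindex L F)) (@Build_Functor E C F0 F1 i c)
    (@Build_Sect E (reindex L (Build_Functor i c)) S0 S1 Si Sc) =
  existT (fun F => Sect (reindex L F)) (@Build_Functor E C F0 F1 i' c')
    (@Build_Sect E (reindex L (Build_Functor i' c')) S0 S1 Si' Sc').
Proof.
  assert (i = i') by apply proof_irrelevance.
  assert (c = c') by apply proof_irrelevance.
  subst i' c'; do 2 f_equal; apply proof_irrelevance.
Qed.

Lemma parts_pair_functor (J1 : Functor E C) (S : SectCat (reindex L J1)) :
  existT (fun F : Functor E C => Sect (reindex L F))
    (fst_part (pair_functor S)) (snd_part (pair_functor S)) = existT _ J1 S.
Proof. destruct J1, S; apply sect_over_eq. Qed.

End Pairs.

Section FibredColimits.
Context {C E : Category} (L : IndexedCategory C).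

Notation rc := (recast (@reind C L)).

(* [L(λ)(Z)]: the structure map at [u : e -> e'] is the inverse compositor,
   precomposed with the identification of [λ_e] with [λ_e' ∘ J1 u]. *)
Program Definition cocone_sect (J1 : Functor E C) (c : Cocone J1) (Z : L (apex c)) :
  SectCat (reindex L J1) :=
  {| sec_ob := fun e => reind L (leg c e) Z;
     sec_map := fun e e' u =>
       comp (C := reind L (fmap J1 u) (reind L (leg c e') Z))
         (iso_bwd (compositor L (fmap J1 u) (leg c e')) Z)
         (rc (eq_sym (leg_comp c u)) Z) |}.
Next Obligation.
  apply compositor_moveL.
  assert (q : leg c e ∘ idm (J1 e) = leg c e ∘ fmap J1 (idm e)) by now rewrite fmap_id.
  rewrite (recast_compositor_lx _ q).
  rewrite <- (recast_cancel (comp_idr (leg c e)) (eq_sym (comp_idr (leg c e)))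
    (comp (B := reind L (idm (J1 e)) (reind L (leg c e) Z)) _ _)).
  rewrite unitor_law_l, (@comp_idr (L (J1 e))); apply recast_trans.
Qed.
Next Obligation.
  apply compositor_moveL.
  set (a := fmap J1 u); set (b := fmap J1 v).
  assert (q : leg c e'' ∘ (b ∘ a) = leg c e'' ∘ fmap J1 (v ∘ u)) by now rewrite fmap_comp.
  assert (r : leg c e' ∘ a = (leg c e'' ∘ b) ∘ a) by (subst b; now rewrite leg_comp).
  rewrite !(@comp_assoc (L (J1 e))), (recast_compositor_lx _ q).
  rewrite (compositor_lawx (eq_sym (comp_assoc (leg c e'') b a))).
  rewrite (fmap_comp (reind L a)), !(@comp_assoc (L (J1 e))).
  rewrite fmap_compositor_cancel.
  rewrite (recast_compositor_rx _ r), compositor_cancel, !recast_transx.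
  apply recast_trans.
Qed.

Program Definition cocone_functor (J1 : Functor E C) (c : Cocone J1) :
  Functor (L (apex c)) (SectCat (reindex L J1)) :=
  {| fobj := cocone_sect (c := c);
     fmap := fun Z W z => {| sec_hom := fun e => fmap (reind L (leg c e)) z |} |}.
Next Obligation.
  rewrite comp_assoc, recast_natural, <- !comp_assoc.
  f_equal; symmetry; apply compositor_inv_natural.
Qed.
Next Obligation. apply sect_hom_eq; intros e; apply fmap_id. Qed.
Next Obligation. apply sect_hom_eq; intros e; apply fmap_comp. Qed.

Definition fibred_leg (J : Functor E (Groth L)) (c : Cocone (fst_part J))
  (X : L (apex c)) (u : hom (snd_part J) (cocone_functor c X)) (e : E) :
  hom (J e) (Build_GrothOb (apex c) X : Groth L) :=
  Build_GrothHom (J e) (Build_GrothOb (apex c) X) (leg c e) (u e).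

Program Definition fibred_cocone (J : Functor E (Groth L)) (c : Cocone (fst_part J))
  (X : L (apex c)) (u : hom (snd_part J) (cocone_functor c X)) : Cocone J :=
  {| apex := Build_GrothOb (apex c) X : Groth L; leg := fibred_leg u |}.
Next Obligation.
  apply (groth_hom_eq (m := groth_comp (fibred_leg u e') (fmap J u0))
    (n := fibred_leg u e) (leg_comp c u0)).
  simpl.
  pose proof (sec_hom_comp u u0) as H; simpl in H; rewrite H; clear H.
  rewrite comp_assoc, compositor_cancel; apply recast_cancel.
Qed.

Definition is_fibred_colimit (J : Functor E (Groth L)) (c : Cocone J) : Prop :=
  is_colimit c /\ is_colimit (map_cocone (groth_proj L) c).

Definition has_fibred_colimit (J : Functor E (Groth L)) : Prop :=
  exists c : Cocone J, is_fibred_colimit c.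

End FibredColimits.

(* Main.v *)
From Stdlib Require Import IndefiniteDescription.
Require Import Defs.

(** The projection of the Grothendieck construction onto its base is a
    fibration: a morphism [(f, g) : (A, X) -> (B, Y)] is a vertical morphism
    [g : X -> L(f)(Y)] followed by the cartesian morphism
    [(A, L(f)(Y)) -> (B, Y)], through which every morphism into [(B, Y)] lying
    over a composite with [f] factors uniquely ([cart_factor],
    [cart_factor_unique], [groth_comp_cart]).

    A cocone [d] of [J] is the same thing as a cocone [c] of [J1], an object [X]
    over its apex and a morphism of sections [u : J2 -> L(c)(X)].  If [c] is a
    colimit, then [d] is a colimit exactly when [u] is a universal arrow from
    [J2] to [L(c)].  Indeed, let [d'] be a second cocone, with apex [(B, Y)].
    The base of a morphism [d -> d'] must be the comparison [f] out of the
    colimit [c].  Factoring the legs of [d'] through the cartesian morphism over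
    [f] turns [d'] into a morphism of sections [J2 -> L(c)(L(f)(Y))], and a
    morphism [d -> d'] over [f] becomes a factorisation of it through [u]; so
    universality of [u] makes [d] a colimit ([fibred_cocone_colimit]).
    Conversely, if [d] is a colimit, its universal property at the cocones over
    [c] itself produces only morphisms over the identity, that is, vertical
    ones, and this is universality of [u] ([colimit_universal_arrow]).

    This settles the case of the single diagram [J].  If every section of
    [L o J1] gives a diagram with a fibred colimit, the resulting colimits of
    [J1] vary with the section; being isomorphic, they may be replaced by a
    fixed one, because the projection lifts isomorphisms
    ([fibred_colimit_over]).  Universal arrows at all sections for one and the
    same functor then assemble to a left adjoint, by choice
    ([left_adjoint_pointwise]). *)

Set Implicit Arguments.
Unset Strict Implicit.
Unset Printing Implicit Defensive.

Local Open Scope cat_scope.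

(** * Colimits *)

Lemma colimit_hom_eq (E C : Category) (J : Functor E C) (c : Cocone J)
  (X : C) (f g : hom (apex c) X) :
  is_colimit c -> (forall e, f ∘ leg c e = g ∘ leg c e) -> f = g.
Proof.
  intros Hc H.
  unshelve epose (d := {| apex := X; leg := fun e => g ∘ leg c e |} : Cocone J).
  { intros e e' u; simpl; now rewrite comp_assoc, leg_comp. }
  destruct (Hc d) as [h [_ Hu]].
  transitivity h; [symmetry|]; apply Hu; auto.
Qed.

Lemma colimit_iso (E C : Category) (J : Functor E C) (c c' : Cocone J) :
  is_colimit c -> is_colimit c' ->
  exists (k : hom (apex c) (apex c')) (i : hom (apex c') (apex c)),
    i ∘ k = idm _ /\ k ∘ i = idm _ /\ forall e, k ∘ leg c e = leg c' e.
Proof.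
  intros Hc Hc'.
  destruct (Hc c') as [k [Hk _]], (Hc' c) as [i [Hi _]].
  exists k, i; split; [|split]; trivial.
  - apply (colimit_hom_eq Hc); intros e.
    now rewrite comp_assoc, Hk, Hi, comp_idl.
  - apply (colimit_hom_eq Hc'); intros e.
    now rewrite comp_assoc, Hi, Hk, comp_idl.
Qed.

Definition extend_cocone (E C : Category) (J : Functor E C) (c : Cocone J)
  (X : C) (k : hom (apex c) X) : Cocone J.
Proof.
  refine {| apex := X; leg := fun e => k ∘ leg c e |}.
  intros e e' u; simpl; now rewrite comp_assoc, leg_comp.
Defined.

Lemma extend_colimit (E C : Category) (J : Functor E C) (c : Cocone J)
  (X : C) (k : hom (apex c) X) (i : hom X (apex c)) :
  i ∘ k = idm _ -> k ∘ i = idm _ -> is_colimit c -> is_colimit (extend_cocone k).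
Proof.
  intros ik ki Hc d; destruct (Hc d) as [f [Hf Hu]].
  exists (f ∘ i); split; simpl.
  - intros e; now rewrite comp_assoc, <- (comp_assoc i), ik, comp_idl, Hf.
  - intros g Hg; rewrite (Hu (g ∘ k)).
    + now rewrite comp_assoc, ki, comp_idr.
    + intros e; rewrite comp_assoc; apply Hg.
Qed.

Lemma cocone_eq (E C : Category) (J : Functor E C) (X : C)
  (l l' : forall e, hom (J e) X) p p' :
  (forall e, l e = l' e) ->
  @Build_Cocone E C J X l p = @Build_Cocone E C J X l' p'.
Proof.
  intros H.
  assert (l = l') as ->
    by now apply FunctionalExtensionality.functional_extensionality_dep.
  f_equal; apply ProofIrrelevance.proof_irrelevance.
Qed.

(** * Left adjoints and universal arrows *)

(** The factorisation of [f] through the unit is its transpose, the counit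
    after [F f]. *)
Lemma adjunction_universal (A B : Category) (F : Functor A B) (U : Functor B A)
  (adj : Adjunction F U) (S : A) :
  is_universal_arrow (X := F S) (adj_unit adj S : hom S (U (F S))).
Proof.
  intros Y f.
  exists (adj_counit adj Y ∘ fmap F f); split.
  - simpl; rewrite fmap_comp, comp_assoc.
    pose proof (naturality (adj_unit adj) f) as N; simpl in N.
    rewrite <- N, <- comp_assoc.
    pose proof (adj_triangle_r adj Y) as T; simpl in T.
    rewrite T; apply comp_idl.
  - intros g <-; simpl.
    pose proof (naturality (adj_counit adj) g) as N; simpl in N.
    rewrite fmap_comp, <- comp_assoc, N, comp_assoc.
    pose proof (adj_triangle_l adj S) as T; simpl in T.
    rewrite T; apply comp_idr.
Qed.

Lemma universal_arrow_eq (A B : Category) (U : Functor B A) (S : A) (X : B)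
  (u : hom S (U X)) (Y : B) (g h : hom X Y) :
  is_universal_arrow u -> fmap U g ∘ u = fmap U h ∘ u -> g = h.
Proof.
  intros H E; destruct (H Y (fmap U h ∘ u)) as [k [_ Hk]].
  transitivity k; [symmetry|]; now apply Hk.
Qed.

(** Existence of universal arrows is a proposition, so choice selects the values
    of the left adjoint; its action on morphisms is forced by universality. *)
Lemma left_adjoint_pointwise (A B : Category) (U : Functor B A) :
  (forall S, has_left_adjoint_at U S) -> has_left_adjoint U.
Proof.
  intros H.
  pose (X S := proj1_sig (constructive_indefinite_description _ (H S))).
  pose (Hu S := constructive_indefinite_description _
    (proj2_sig (constructive_indefinite_description _ (H S)))).
  pose (u S := proj1_sig (Hu S) : hom S (U (X S))).
  assert (univ : forall S, is_universal_arrow (u S)) by (intros S; apply (proj2_sig (Hu S))).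
  clearbody u; clear Hu; clearbody X.
  assert (ext : forall S Y (f : hom S (U Y)), {g : hom (X S) Y | fmap U g ∘ u S = f}).
  { intros S Y f; apply constructive_indefinite_description.
    destruct (univ S Y f) as [g [Hg _]]; now exists g. }
  unshelve epose (F := {| fobj := X;
    fmap := fun S T f => proj1_sig (ext S (X T) (u T ∘ f)) |} : Functor A B).
  { intros S; apply (universal_arrow_eq (univ S)).
    now rewrite (proj2_sig (ext _ _ _)), fmap_id, comp_idl, comp_idr. }
  { intros S T V g f; apply (universal_arrow_eq (univ S)).
    rewrite (proj2_sig (ext _ _ _)), fmap_comp, comp_assoc, (proj2_sig (ext _ _ _)).
    now rewrite <- !comp_assoc, (proj2_sig (ext _ _ _)). }
  unshelve epose (eta := @Build_NatTrans A A (id_functor A) (comp_functor U F) u _).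
  { intros S T f; simpl; now rewrite (proj2_sig (ext _ _ _)). }
  unshelve epose (eps := @Build_NatTrans B B (comp_functor F U) (id_functor B)
    (fun Y => proj1_sig (ext (U Y) Y (idm (U Y)))) _).
  { intros Y Z f; simpl; apply (universal_arrow_eq (univ (U Y))).
    rewrite !fmap_comp, !comp_assoc, !(proj2_sig (ext _ _ _)).
    now rewrite <- comp_assoc, (proj2_sig (ext _ _ _)), comp_idl, comp_idr. }
  exists F; constructor; apply (Build_Adjunction (adj_unit := eta) (adj_counit := eps)).
  - intros S; simpl; apply (universal_arrow_eq (univ S)).
    rewrite fmap_comp, comp_assoc, (proj2_sig (ext _ _ _)).
    now rewrite <- comp_assoc, (proj2_sig (ext _ _ _)), fmap_id.
  - intros Y; simpl; apply (proj2_sig (ext _ _ _)).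
Qed.

(** * The Grothendieck construction as a fibration *)

Section Fibration.
Context {C : Category} (L : IndexedCategory C).

Notation rc := (recast (@reind C L)).
Notation "⟨ A , X ⟩" := (Build_GrothOb (L := L) A X : Groth L).
(* A pair typed as a morphism of [Groth L], so that it can be composed. *)
Notation arrow P Q g x := (Build_GrothHom P Q g x : @hom (Groth L) P Q).

Definition cart (A B : C) (f : hom A B) (Y : L B) :
  hom ⟨A, reind L f Y⟩ ⟨B, Y⟩ :=
  arrow ⟨A, reind L f Y⟩ ⟨B, Y⟩ f (idm _).

Lemma cart_comp_snd (A B : C) (f : hom A B) (Y : L B) (P : Groth L)
  (m : hom P ⟨A, reind L f Y⟩) :
  gsnd (cart f Y ∘ m) =
  comp (B := reind L (gfst m) (reind L f Y)) (compositor L (gfst m) f Y) (gsnd m).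
Proof. simpl; now rewrite fmap_id, comp_idl. Qed.

Lemma groth_pair_inj (P Q : Groth L) (g : hom (gbase P) (gbase Q))
  (x y : hom (gfib P) (reind L g (gfib Q))) :
  arrow P Q g x = arrow P Q g y -> x = y.
Proof.
  intros H; pose proof (groth_hom_eq_snd H eq_refl) as K; simpl in K.
  now rewrite comp_idl in K.
Qed.

(** Postcomposition with a cartesian morphism only applies a compositor, an
    isomorphism, to the fibre component. *)
Lemma cart_factor_unique (A B : C) (f : hom A B) (Y : L B) (P : Groth L)
  (m n : hom P ⟨A, reind L f Y⟩) :
  gfst m = gfst n -> cart f Y ∘ m = cart f Y ∘ n -> m = n.
Proof.
  destruct m as [g x], n as [g' y]; simpl gfst; intros <- H.
  pose proof (groth_hom_eq_snd H eq_refl) as K; simpl in K.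
  rewrite !fmap_id, !comp_idl in K.
  f_equal; rewrite <- (compositor_moveL K); now apply compositor_moveL.
Qed.

(** The fibre component of the factorisation is that of [d], carried to
    [L(f o g)(Y)] and then through the inverse compositor.  It is a sigma type
    because the components of several legs are later collected in a section. *)
Lemma cart_factor (A B : C) (f : hom A B) (Y : L B) (P : Groth L)
  (d : hom P ⟨B, Y⟩) (g : hom (gbase P) A) :
  f ∘ g = gfst d ->
  {x : hom (gfib P) (reind L g (reind L f Y)) |
    cart f Y ∘ arrow P ⟨A, reind L f Y⟩ g x = d}.
Proof.
  intros p.
  exists (comp (C := reind L g (reind L f Y)) (iso_bwd (compositor L g f) Y)
    (rc (eq_sym p) Y ∘ gsnd d)).
  apply (groth_hom_eq (m := cart f Y ∘ arrow P ⟨A, reind L f Y⟩ g _) (n := d) p).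
  rewrite cart_comp_snd; simpl gsnd; simpl gfst.
  rewrite compositor_cancel; apply recast_cancel.
Qed.

(** A cartesian morphism over an isomorphism is an isomorphism: the inverse
    factors the identity, and it is two-sided by uniqueness of factorisations. *)
Lemma iso_cart (A B : C) (f : hom A B) (k : hom B A) (Y : L B) :
  f ∘ k = idm B -> k ∘ f = idm A ->
  exists m : hom ⟨B, Y⟩ ⟨A, reind L f Y⟩,
    gfst m = k /\ cart f Y ∘ m = idm _ /\ m ∘ cart f Y = idm _.
Proof.
  intros fk kf.
  destruct (@cart_factor A B f Y ⟨B, Y⟩ (idm _) k fk) as [x Hx].
  exists (arrow ⟨B, Y⟩ ⟨A, reind L f Y⟩ k x).
  split; [reflexivity | split; [exact Hx|]].
  apply cart_factor_unique; [exact kf|].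
  now rewrite <- comp_assoc, Hx, comp_idl, comp_idr.
Qed.

Definition vert (A : C) (X Y : L A) (z : hom X Y) : hom ⟨A, X⟩ ⟨A, Y⟩ :=
  arrow ⟨A, X⟩ ⟨A, Y⟩ (idm A) (comp (B := Y) (unitor L A Y) z).

(** Together with the next lemma: the fibre over [A] embeds in [Groth L] with
    image the morphisms over the identity, as the unitor is invertible. *)
Lemma vert_inj (A : C) (X Y : L A) (z w : hom X Y) : vert z = vert w -> z = w.
Proof.
  intros H; apply groth_pair_inj in H.
  rewrite <- (comp_idl z), <- (comp_idl w), <- (unitor_bwd_fwd Y), !comp_assoc.
  now f_equal.
Qed.

Lemma vert_of_fst_id (A : C) (X Y : L A) (m : hom ⟨A, X⟩ ⟨A, Y⟩) :
  gfst m = idm A -> exists z : hom X Y, m = vert z.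
Proof.
  destruct m as [g x]; simpl in *; intros ->.
  exists (comp (C := Y) (iso_bwd (unitor L A) Y) x); unfold vert.
  now rewrite unitor_cancel.
Qed.

(** The right unit law of [L] cancels the compositor against the unitor of
    [vert z]. *)
Lemma vert_comp (A : C) (X Y : L A) (z : hom X Y) (P : Groth L)
  (g : hom (gbase P) A) (x : hom (gfib P) (reind L g X)) :
  vert z ∘ arrow P ⟨A, X⟩ g x =
  arrow P ⟨A, Y⟩ g (fmap (reind L g) z ∘ x).
Proof.
  apply (groth_hom_eq (m := vert z ∘ arrow P ⟨A, X⟩ g x)
    (n := arrow P ⟨A, Y⟩ g (fmap (reind L g) z ∘ x)) (comp_idl g)).
  simpl; rewrite fmap_comp, <- !comp_assoc.
  rewrite (comp_assoc (rc _ _)), unitor_law_r; now rewrite comp_idl.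
Qed.

Lemma cart_vert (A B : C) (f : hom A B) (X : L A) (Y : L B)
  (z : hom X (reind L f Y)) :
  cart f Y ∘ vert z = arrow ⟨A, X⟩ ⟨B, Y⟩ f z.
Proof.
  apply (groth_hom_eq (m := cart f Y ∘ vert z)
    (n := arrow ⟨A, X⟩ ⟨B, Y⟩ f z) (comp_idr f)).
  rewrite cart_comp_snd; simpl.
  rewrite <- !comp_assoc, (comp_assoc (rc _ _)), unitor_law_l; apply comp_idl.
Qed.

(** Reduces composition with an arbitrary morphism over [f] to [L(g)] applied in
    the fibre, the form in which sections are composed. *)
Lemma groth_comp_cart (A B : C) (f : hom A B) (X : L A) (Y : L B)
  (z : hom X (reind L f Y)) (P : Groth L)
  (g : hom (gbase P) A) (x : hom (gfib P) (reind L g X)) :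
  arrow ⟨A, X⟩ ⟨B, Y⟩ f z ∘ arrow P ⟨A, X⟩ g x =
  cart f Y ∘ arrow P ⟨A, reind L f Y⟩ g (fmap (reind L g) z ∘ x).
Proof. rewrite <- (cart_vert z), <- (vert_comp z x); apply comp_assoc. Qed.

End Fibration.

(** * Cocones of a functor into the Grothendieck construction *)

Section Cocones.
Context {C E : Category} {L : IndexedCategory C} (J : Functor E (Groth L)).

Notation "⟨ A , X ⟩" := (Build_GrothOb (L := L) A X : Groth L).
Notation arrow P Q g x := (Build_GrothHom P Q g x : @hom (Groth L) P Q).

(** Commutation of the pairs with [J u] is the compatibility of [x] with the
    structure maps of [J2] and [L(c)(Z)], moved across the inverse compositor in
    the latter. *)
Definition sect_hom_of_legs (c : Cocone (fst_part J)) (Z : L (apex c))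
  (x : forall e, hom (gfib (J e)) (reind L (leg c e) Z))
  (Hx : forall e e' (u : hom e e'),
     arrow (J e') ⟨apex c, Z⟩ (leg c e') (x e') ∘ fmap J u =
     arrow (J e) ⟨apex c, Z⟩ (leg c e) (x e)) :
  hom (snd_part J) (cocone_functor L c Z).
Proof.
  refine (@Build_SectHom _ _ (snd_part J) (cocone_functor L c Z) x _).
  intros e e' u; simpl; symmetry.
  rewrite comp_assoc; apply compositor_moveL.
  pose proof (groth_hom_eq_snd (Hx e e' u) (leg_comp c u)) as K; simpl in K.
  now rewrite <- K, recast_cancel.
Defined.

(** Every cocone [d] of [J] is a fibred cocone: [fibred_cocone (cocone_arrow d)]
    has, up to conversion, the apex and legs of [d]. *)
Definition cocone_arrow (d : Cocone J) :
  hom (snd_part J) (cocone_functor L (map_cocone (groth_proj L) d) (gfib (apex d))).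
Proof.
  apply (@sect_hom_of_legs (map_cocone (groth_proj L) d) (gfib (apex d))
    (fun e => gsnd (leg d e))).
  intros e e' u; exact (leg_comp d u).
Defined.

(** The legs of a cocone [d], factored through the cartesian morphism over the
    comparison [f] of base colimits, form a section morphism, whose
    factorisation through [u] is the fibre component sought. *)
Lemma fibred_cocone_colimit (c : Cocone (fst_part J)) (X : L (apex c))
  (u : hom (snd_part J) (cocone_functor L c X)) :
  is_colimit c -> is_universal_arrow u -> is_colimit (fibred_cocone u).
Proof.
  intros Hc Hu d.
  destruct (Hc (map_cocone (groth_proj L) d)) as [f [Hf _]]; simpl in f, Hf.
  pose (Y := gfib (apex d)).
  pose (x e := @cart_factor C L _ _ f Y (J e) (leg d e) (leg c e) (Hf e)).
  assert (Hx : forall e e' (v : hom e e'),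
     arrow (J e') ⟨apex c, reind L f Y⟩ (leg c e') (proj1_sig (x e')) ∘ fmap J v =
     arrow (J e) ⟨apex c, reind L f Y⟩ (leg c e) (proj1_sig (x e))).
  { intros e e' v; apply cart_factor_unique; [exact (leg_comp c v)|].
    rewrite <- comp_assoc, (proj2_sig (x e')), (proj2_sig (x e)).
    exact (leg_comp d v). }
  destruct (Hu (reind L f Y) (sect_hom_of_legs Hx)) as [g [Hg Hg']].
  exists (arrow ⟨apex c, X⟩ (apex d) f g); split.
  - intros e.
    etransitivity; [apply groth_comp_cart|].
    etransitivity; [|exact (proj2_sig (x e))].
    exact (f_equal (fun w => cart f Y ∘ fibred_leg w e) Hg).
  - intros [f' g'] Hm.
    (* The base component is forced first; only then are the fibre components
       comparable. *)
    assert (p : f = f').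
    { apply (colimit_hom_eq Hc); intros e.
      etransitivity; [apply Hf | symmetry; exact (f_equal (@gfst C L _ _) (Hm e))]. }
    subst f'; f_equal; apply Hg', sect_hom_eq; intros e.
    apply (groth_pair_inj (L := L) (P := J e) (Q := ⟨apex c, reind L f Y⟩)).
    apply cart_factor_unique; [reflexivity|].
    etransitivity; [|symmetry; exact (proj2_sig (x e))].
    rewrite <- (Hm e); symmetry; apply groth_comp_cart.
Qed.

(** A section morphism [J2 -> L(c)(Y)] is a cocone of [J] over [c]; the mediating
    morphism is over an endomorphism fixing the legs of [c], hence vertical. *)
Lemma colimit_universal_arrow (c : Cocone (fst_part J)) (X : L (apex c))
  (u : hom (snd_part J) (cocone_functor L c X)) :
  is_colimit c -> is_colimit (fibred_cocone u) -> is_universal_arrow u.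
Proof.
  intros Hc Hu Y h.
  destruct (Hu (fibred_cocone h)) as [m [Hm Hm']].
  assert (p : gfst m = idm (apex c)).
  { apply (colimit_hom_eq Hc); intros e; rewrite comp_idl.
    exact (f_equal (@gfst C L _ _) (Hm e)). }
  destruct (vert_of_fst_id p) as [z ->].
  exists z; split.
  - apply sect_hom_eq; intros e.
    apply (groth_pair_inj (L := L) (P := J e) (Q := ⟨apex c, Y⟩)).
    etransitivity; [|exact (Hm e)]; symmetry; apply vert_comp.
  - intros w Hw; apply vert_inj, Hm'; intros e.
    etransitivity; [apply vert_comp|].
    exact (f_equal (fun v => fibred_leg v e) Hw).
Qed.

Lemma universal_arrow_fibred_colimit (c : Cocone (fst_part J)) (X : L (apex c))
  (u : hom (snd_part J) (cocone_functor L c X)) :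
  is_colimit c -> is_universal_arrow u -> is_fibred_colimit (fibred_cocone u).
Proof.
  intros Hc Hu; split; [now apply fibred_cocone_colimit | exact Hc].
Qed.

Lemma fibred_colimit_arrow (d : Cocone J) :
  is_fibred_colimit d -> is_universal_arrow (cocone_arrow d).
Proof.
  intros [Hd Hc]; apply colimit_universal_arrow; [exact Hc | exact Hd].
Qed.

Lemma fibred_colimit_iff :
  has_fibred_colimit J <->
  exists c : Cocone (fst_part J),
    is_colimit c /\ has_left_adjoint_at (cocone_functor L c) (snd_part J).
Proof.
  split.
  - intros [d Hd]; exists (map_cocone (groth_proj L) d); split; [apply Hd|].
    exists (gfib (apex d)), (cocone_arrow d); now apply fibred_colimit_arrow.
  - intros [c [Hc [X [u Hu]]]].
    exists (fibred_cocone u); now apply universal_arrow_fibred_colimit.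
Qed.

(** A fibred colimit [d] lies over some colimit of [J1], isomorphic to the given
    [c].  The cartesian morphism over the isomorphism [i] of apexes is
    invertible; composing the legs of [d] with its inverse gives a fibred colimit
    over [c] itself. *)
Lemma fibred_colimit_over (c : Cocone (fst_part J)) :
  has_fibred_colimit J -> is_colimit c ->
  has_left_adjoint_at (cocone_functor L c) (snd_part J).
Proof.
  intros [d [Hd Hpd]] Hc.
  destruct (colimit_iso Hpd Hc) as [k [i [ik [ki Hk]]]]; simpl in k, i, ik, ki, Hk.
  destruct (@iso_cart C L _ _ i k (gfib (apex d)) ik ki) as [m [Hm [Hl Hr]]].
  pose (d' := extend_cocone (m : hom (apex d) _)).
  assert (Hd' : is_colimit d') by exact (extend_colimit Hl Hr Hd).
  assert (Hc' : map_cocone (groth_proj L) d' = c).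
  { destruct c as [B l lc]; apply cocone_eq; intros e.
    etransitivity; [|exact (Hk e)]; simpl; now rewrite Hm. }
  rewrite <- Hc'.
  exists (gfib (apex d')), (cocone_arrow d'); apply fibred_colimit_arrow.
  split; [exact Hd' | now rewrite Hc'].
Qed.

End Cocones.

(** The parts of [pair_functor S] agree with [J1] and [S] only up to proofs of
    functoriality.  The right-hand side is therefore stated over a dependent pair
    [T], which is rewritten as a whole. *)
Lemma pair_functor_has_fibred_colimit (C E : Category) (L : IndexedCategory C)
  (J1 : Functor E C) (c : Cocone J1) (S : SectCat (reindex L J1)) :
  is_colimit c ->
  (has_fibred_colimit (pair_functor S) <->
   has_left_adjoint_at (cocone_functor L c) S).
Proof.
  intros Hc.
  pose (P (T : {F : Functor E C & Sect (reindex L F)}) :=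
    forall c : Cocone (projT1 T), is_colimit c ->
      (has_fibred_colimit (pair_functor S) <->
       has_left_adjoint_at (cocone_functor L c) (projT2 T))).
  enough (HP : P (existT _ J1 S)) by exact (HP c Hc).
  rewrite <- parts_pair_functor; intros c' Hc'; split.
  - intros H; now apply fibred_colimit_over.
  - intros H; apply fibred_colimit_iff; now exists c'.
Qed.

(** * Characterisation of fibred colimits *)

Theorem theorem6p3 (C : Category) (L : IndexedCategory C) (E : Category)
  (J : Functor E (Groth L)) :
  let J1 := fst_part J in
  let J2 := snd_part J in
  (has_fibred_colimit J <->
    exists c : Cocone J1,
      is_colimit c /\ has_left_adjoint_at (cocone_functor L c) J2) /\
  ((forall S : SectCat (reindex L J1), has_fibred_colimit (pair_functor S)) <->
    exists c : Cocone J1,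
      is_colimit c /\ has_left_adjoint (cocone_functor L c)) /\
  (forall c : Cocone J1, is_colimit c ->
    forall (X : L (apex c)) (u : hom J2 (cocone_functor L c X)),
      is_universal_arrow u -> is_fibred_colimit (fibred_cocone u)) /\
  (forall c : Cocone J1, is_colimit c ->
    forall (F : Functor (SectCat (reindex L J1)) (L (apex c)))
      (adj : Adjunction F (cocone_functor L c)),
      is_fibred_colimit (fibred_cocone (X := F J2) (adj_unit adj J2))).
Proof.
  intros J1 J2; split; [|split; [|split]].
  - apply fibred_colimit_iff.
  - split.
    + intros H.
      assert (HJ : has_fibred_colimit J).
      { rewrite <- (pair_functor_parts J); apply H. }
      apply fibred_colimit_iff in HJ; destruct HJ as [c [Hc _]].
      exists c; split; [exact Hc|].
      apply left_adjoint_pointwise; intros S.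
      now apply pair_functor_has_fibred_colimit.
    + intros [c [Hc [F [adj]]]] S.
      apply (pair_functor_has_fibred_colimit S Hc).
      exists (F S), (adj_unit adj S); apply adjunction_universal.
  - intros c Hc X u Hu; now apply universal_arrow_fibred_colimit.
  - intros c Hc F adj.
    apply universal_arrow_fibred_colimit; [exact Hc | apply adjunction_universal].
Qed.
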